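(* Let $d\ge 1$ and let $\mathcal P=\{P^j\}_{j=1}^d$, where each $P^j=\{p^j_i\}_{i=1}^\infty$ is a sequence of natural numbers different from $1$, and assume $$\sup_{i\in\mathbb N,\,1\le j\le d}p^j_i<\infty .$$ Let $\Psi$ be a complex-valued additive function on the $\mathcal P$-ary parallelepipeds $\Lambda^d$, fix $I_0\in\Lambda^d$, and let $h_m:I_0\to\mathbb R$ ($m\in\mathbb N$) be measurable functions satisfying: (i) $0\le h_1(x)\le h_2(x)\le\dots\le h_m(x)\le\dots$ and $\lim_{m\to\infty}h_m(x)=\infty$; (ii) there is a constant $C>0$ such that for every $m\in\mathbb N$ there are parallelepipeds $I^m_1,\dots,I^m_{n_m}\in\Lambda^d$ with pairwise disjoint interiors and $\bigcup_{k=1}^{n_m}I^m_k=I_0$, satisfying $\sup_{x\in I^m_k}h_m(x)\le C\inf_{x\in I^m_k}h_m(x)$ for all $m\in\mathbb N$, $1\le k\le n_m$; (iii) $\inf_{m,k}\int_{I^m_k}h_m(x)\,dx>0$. Suppose that $$\lim_{m\to\infty}\int_{\{x\in I_0:\ \Psi^*(x)>h_m(x)\}}h_m(x)\,dx=0$$ and that $\Psi'(x)$ exists for almost every $x$. Then for every $I\in\Lambda^d$ with $I\subset I_0$, $$\Psi(I)=\lim_{m\to\infty}\int_I\big[\Psi'(x)\big]_{h_m(x)}\,dx .$$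
   Context: Notation: $m^j_0=1$, $m^j_k=\prod_{i=1}^k p^j_i$. $\Lambda^d_k$ is the set of all $\mathcal P$-ary parallelepipeds of rank $k$: $$I=\Big[\tfrac{n_1}{m^1_k},\tfrac{n_1+1}{m^1_k}\Big]\times\dots\times\Big[\tfrac{n_d}{m^d_k},\tfrac{n_d+1}{m^d_k}\Big],\quad n_1,\dots,n_d\in\mathbb Z,$$ and $\Lambda^d=\bigcup_{k\ge0}\Lambda^d_k$. A complex-valued function $\Psi$ on $\Lambda^d$ is additive if $\Psi(I)=\sum_{i=1}^n\Psi(I_i)$ whenever $I,I_1,\dots,I_n\in\Lambda^d$, $I=\bigcup_i I_i$ and the interiors of the $I_i$ are pairwise disjoint. A point $x=(x_1,\dots,x_d)\in\mathbb R^d$ is $\mathcal P$-irrational if for each $j$ and each $n\in\mathbb N$, $x_j\prod_{i=1}^n p^j_i\notin\mathbb Z$. For $\mathcal P$-irrational $x$: $$\Psi'(x)=\lim_{k\to\infty,\ x\in I_k\in\Lambda^d_k}\frac{\Psi(I_k)}{\mu(I_k)},\qquad \Psi^*(x)=\sup_{I:\ x\in I\in\Lambda^d}\frac{|\Psi(I)|}{\mu(I)},$$ where $\mu$ is Lebesgue measure. For a complex function $f$ and nonnegative function $\lambda$, the truncation is $[f(x)]_{\lambda(x)}=f(x)$ if $|f(x)|\le\lambda(x)$ and $0$ if $|f(x)|>\lambda(x)$. *)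

(* Defs.v *)
From HB Require Import structures.
From mathcomp Require Import all_boot all_order all_algebra.
From mathcomp Require Import all_classical all_reals all_analysis.
From mathcomp Require Import complex.
Set Implicit Arguments. Unset Strict Implicit. Unset Printing Implicit Defensive.
Import Order.TTheory GRing.Theory Num.Theory.
Import numFieldNormedType.Exports.
Local Open Scope classical_set_scope.
Local Open Scope ring_scope.

(* The library's sigma-finiteness instance for [m1 \x m2] is shadowed by the
   subprobability one, so we re-declare it on a thin wrapper. *)
Section prodm.
Local Open Scope ereal_scope.
Context d1 d2 (T1 : measurableType d1) (T2 : measurableType d2) (R : realType).
Variable m1 : {sigma_finite_measure set T1 -> \bar R}.
Variable m2 : {sigma_finite_measure set T2 -> \bar R}.
Definition prodm : set (T1 * T2) -> \bar R := (m1 \x m2)%E.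
HB.instance Definition _ := Measure.copy prodm (m1 \x m2)%E.
Lemma prodm_sigma_finite : sigma_finite setT prodm.
Proof.
have /sigma_finiteP[F [TF ndF Foo]] := sigma_finiteT m1.
have /sigma_finiteP[G [TG ndG Goo]] := sigma_finiteT m2.
exists (fun n => F n `*` G n).
 rewrite -setXTT TF TG predeqE => -[x y]; split.
    move=> [/= [n _ Fnx] [k _ Gky]]; exists (maxn n k) => //; split.
    - by move: x Fnx; exact/subsetPset/ndF/leq_maxl.
    - by move: y Gky; exact/subsetPset/ndG/leq_maxr.
  by move=> [n _ []/= ? ?]; split; exists n.
move=> k; have [? ?] := Foo k; have [? ?] := Goo k.
split; first exact: measurableX.
by rewrite /prodm product_measure1E// lte_mul_pinfty// ge0_fin_numE.
Qed.
HB.instance Definition _ := Measure_isSigmaFinite.Build _ _ _ prodm prodm_sigma_finite.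
End prodm.

Record mspace (R : realType) := MSpace {
  ms_disp : measure_display;
  ms_type : measurableType ms_disp;
  ms_meas : {sigma_finite_measure set ms_type -> \bar R} }.

(* lebn R n : R^(n+1) as nested pairs R * (R * ... R), with the product of
   Borel-Lebesgue measures *)
Fixpoint lebn (R : realType) (n : nat) : mspace R :=
  match n with
  | 0 => @MSpace R _ _ (@lebesgue_measure R)
  | n'.+1 => let M := lebn R n' in
     @MSpace R _ _ (prodm (@lebesgue_measure R) (ms_meas M))
  end.

Fixpoint coordn (R : realType) (n : nat) : ms_type (lebn R n) -> nat -> R :=
  match n return ms_type (lebn R n) -> nat -> R with
  | 0 => fun x _ => x
  | n'.+1 => fun x j => match j with 0 => x.1 | j'.+1 => coordn x.2 j' end
  end.

(* R^d (d >= 1) equipped with the sigma-algebra of Lebesgue measurable sets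
   (Caratheodory completion of the product Borel measure). *)
Definition Rspace (R : realType) (d : nat) :=
  caratheodory_type (ms_meas (lebn R d.-1))^*%mu.

Definition lebd (R : realType) (d : nat) : set (Rspace R d) -> \bar R :=
  @completed_measure_extension _ _ _ (ms_meas (lebn R d.-1)).

Definition coord (R : realType) (d : nat) (x : Rspace R d) (j : nat) : R :=
  @coordn R d.-1 x j.

Section Pary.
Variables (R : realType) (d : nat) (P : nat -> nat -> nat).
(* P j i = p^{j+1}_i : coordinate j is 0-based, index i >= 1 *)

Definition mjk (j k : nat) : nat := \prod_(1 <= i < k.+1) P j i.

Definition box (k : nat) (n : nat -> int) : set (Rspace R d) :=
  [set x | forall j, (j < d)%N ->
     (n j)%:~R / (mjk j k)%:R <= coord x j <= (n j + 1)%:~R / (mjk j k)%:R].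

Definition Lambda_k (k : nat) (I : set (Rspace R d)) : Prop :=
  exists n : nat -> int, I = box k n.

Definition Lambda (I : set (Rspace R d)) : Prop := exists k, Lambda_k k I.

Definition interior_d (S : set (Rspace R d)) : set (Rspace R d) :=
  [set x | exists e : R, 0 < e /\
     forall y : Rspace R d, (forall j, (j < d)%N -> `|coord y j - coord x j| < e) -> S y].

Definition additive_P (Psi : set (Rspace R d) -> R[i]) : Prop :=
  forall (I : set (Rspace R d)) (n : nat) (F : 'I_n -> set (Rspace R d)),
    Lambda I -> (forall i, Lambda (F i)) ->
    I = \big[setU/set0]_(i < n) F i ->
    (forall i i', i != i' -> interior_d (F i) `&` interior_d (F i') = set0) ->
    Psi I = \sum_(i < n) Psi (F i).

Definition P_irrational (x : Rspace R d) : Prop :=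
  forall j, (j < d)%N -> forall n, (1 <= n)%N ->
    ~ (exists z : int, coord x j * (mjk j n)%:R = z%:~R).

Local Open Scope complex_scope.
Definition cmod (z : R[i]) : R := Num.sqrt (complex.Re z ^+ 2 + complex.Im z ^+ 2).

Definition mu (I : set (Rspace R d)) : R := fine (lebd I).

Definition is_Pderiv (Psi : set (Rspace R d) -> R[i]) (x : Rspace R d) (L : R[i]) : Prop :=
  forall e : R, 0 < e -> exists K : nat, forall k, (K <= k)%N ->
    forall I, Lambda_k k I -> I x ->
      cmod (Psi I * ((mu I)^-1)%:C - L) < e.

(* Psi'(x) (meaningful where it exists at a P-irrational x; 0 elsewhere) *)
Definition Pderiv (Psi : set (Rspace R d) -> R[i]) (x : Rspace R d) : R[i] :=
  xget 0 [set L | P_irrational x /\ is_Pderiv Psi x L].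

Definition Pmax (Psi : set (Rspace R d) -> R[i]) (x : Rspace R d) : \bar R :=
  ereal_sup [set ((cmod (Psi I)) / mu I)%:E | I in [set I | Lambda I /\ I x]].

Definition trunc (f : Rspace R d -> R[i]) (lam : Rspace R d -> R) (x : Rspace R d) : R[i] :=
  if cmod (f x) <= lam x then f x else 0.

Definition cintegral (A : set (Rspace R d)) (f : Rspace R d -> R[i]) : R[i] :=
  Complex (Rintegral (@lebd R d) A (fun x => complex.Re (f x)))
          (Rintegral (@lebd R d) A (fun x => complex.Im (f x))).

End Pary.

(* Main.v *)
(** Let [E_m] be the set where [Psi^* > h_m], enlarged by the null set where the
    derivative does not exist.  On a parallelepiped on which [h_m] is comparable to
    a constant [L], hypothesis (iii) and the smallness of the integral of [h_m] over
    [E_m] force [E_m] to have small density.  Descend from it to smaller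
    parallelepipeds and stop as soon as [E_m] has density more than [1 / (2 D)],
    where [D] bounds the number of children of a parallelepiped.  A stopped cell
    still has density at most [1 / 2], hence contains a point outside [E_m], so on it
    [Psi] and the integral of [[Psi']_{h_m}] are both at most
    [L mu(cell) <= 2 D L mu(E_m /\ cell)].  Off the stopped cells the averages of
    [Psi] are bounded by [L] and converge to [Psi'] almost everywhere, so dominated
    convergence gives [|Psi(I) - \int_I [Psi']_{h_m}| <= 4 D L mu(E_m /\ I)], which
    is controlled by the integral of [h_m] over [E_m].  Summing over the
    parallelepipeds of (ii) gives the theorem when they subdivide [I]; otherwise [I]
    lies inside one of them, and the same estimate applies to [I] itself for large
    [m], because [h_m] tends to infinity. *)
Require Import Defs.
From HB Require Import structures.
From mathcomp Require Import all_boot all_order all_algebra.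
From mathcomp Require Import all_classical all_reals all_analysis.
From mathcomp Require Import measurable_realfun complex.
From mathcomp Require Import zify ring lra.
Import Order.TTheory GRing.Theory Num.Theory.
Import numFieldNormedType.Exports.
Local Open Scope classical_set_scope.
Local Open Scope ring_scope.
Set Implicit Arguments. Unset Strict Implicit. Unset Printing Implicit Defensive.

(** * Real-valued integrals: integrability, finite unions, comparison *)

Section RintegralExtra.
Context {disp} {T : measurableType disp} {R : realType}.
Variable nu : {measure set T -> \bar R}.

Lemma bounded_integrable (D : set T) (M : R) (f : T -> R) :
  measurable D -> (nu D < +oo)%E -> measurable_fun D f ->
  (forall x, D x -> `|f x| <= M) -> nu.-integrable D (EFin \o f).
Proof.
move=> mD Doo mf fM; apply: measurable_bounded_integrable => //.
exists M; split; first exact: num_real.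
by move=> y My x /= Dx; exact: le_trans (fM x Dx) (ltW My).
Qed.

Lemma Rintegral_bigsetU (I : choiceType) (s : seq I) (F : I -> set T) (f : T -> R) :
  (forall i, measurable (F i)) -> uniq s -> trivIset setT F ->
  nu.-integrable (\big[setU/set0]_(i <- s) F i) (EFin \o f) ->
  Rintegral nu (\big[setU/set0]_(i <- s) F i) f =
  \sum_(i <- s) Rintegral nu (F i) f.
Proof.
move=> mF us tF fi; rewrite /Rintegral integral_bigsetU_EFin //; last 2 first.
- by apply: sub_trivIset tF.
- by case/integrableP: fi.
rewrite big_seq [RHS]big_seq sum_fine // => i si.
apply: integrable_fin_num => //; apply: integrableS fi => //.
- exact: bigsetU_measurable.
- by move=> x Fx; rewrite -bigcup_seq; exists i.
Qed.

Lemma le_abs_Rintegral (D : set T) (f g : T -> R) :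
  measurable D -> nu.-integrable D (EFin \o f) -> nu.-integrable D (EFin \o g) ->
  (forall x, D x -> `|f x| <= g x) -> `|Rintegral nu D f| <= Rintegral nu D g.
Proof.
move=> mD fi gi fg; apply: le_trans (le_normr_Rintegral mD fi) _.
apply: le_Rintegral => //.
by have := integrable_abse fi; exact: eq_integrable.
Qed.

End RintegralExtra.

(** * Additive functions on a tree of cells *)

Section CellTree.
Context {disp} {T : measurableType disp} {R : realType}.
Variables (nu : {measure set T -> \bar R}) (A : countType).
Variables (c : nat -> T -> A) (ch : nat -> A -> seq A) (v : nat -> R) (D : R).

Local Notation cell k a := (c k @^-1` [set a]).

Hypothesis cell_measurable : forall k a, measurable (cell k a).
Hypothesis nu_cell : forall k a, nu (cell k a) = (v k)%:E.
Hypothesis v_gt0 : forall k, 0 < v k.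
Hypothesis D_ge1 : 1 <= D.
Hypothesis v_doubling : forall k, v k <= D * v k.+1.
Hypothesis ch_uniq : forall k a, uniq (ch k a).
(** The only link between consecutive ranks: it yields both the nesting of the cells and the fact
    that the children listed in [ch k a] exhaust the cell of [a]. *)
Hypothesis mem_ch : forall k x a, (c k.+1 x \in ch k a) = (c k x == a).

Lemma cell_bigsetU k a : cell k a = \big[setU/set0]_(a' <- ch k a) cell k.+1 a'.
Proof.
rewrite -bigcup_seq; apply/seteqP; split => [x /= xa|x [a' /= a'ch xa']].
  by exists (c k.+1 x) => //=; rewrite mem_ch; apply/eqP.
by apply/eqP; rewrite -mem_ch xa'.
Qed.

Lemma cell_child k a a' : a' \in ch k a -> cell k.+1 a' `<=` cell k a.
Proof. by move=> a'a x xa'; apply/eqP; rewrite -mem_ch xa'. Qed.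

Lemma Rintegral_cell k a (f : T -> R) : nu.-integrable (cell k a) (EFin \o f) ->
  Rintegral nu (cell k a) f = \sum_(a' <- ch k a) Rintegral nu (cell k.+1 a') f.
Proof.
rewrite {1 2}cell_bigsetU => fi; rewrite Rintegral_bigsetU //.
by move=> i j _ _ [x [<- <-]].
Qed.

(** There are countably many codes, so a preimage is a countable union of cells. *)
Lemma measurable_code k (B : set T) d' (U : measurableType d') (f : A -> U) :
  measurable B -> measurable_fun B (f \o c k).
Proof.
move=> mB; apply: (measurable_funS measurableT) => // _ Y mY; rewrite setTI.
have -> : (f \o c k) @^-1` Y = \bigcup_(a in f @^-1` Y) cell k a.
  apply/seteqP; split => [x Yx|x [a Ya /= xa]]; first by exists (c k x).
  by rewrite /preimage /= xa.
rewrite bigcup_mkcond; apply: countable_bigcupT_measurable => [|a].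
  exact: countableP.
by case: ifP.
Qed.

Lemma code_coarse k k' x y : (k' <= k)%N -> c k x = c k y -> c k' x = c k' y.
Proof.
move=> /subnK <-; elim: (k - k')%N => // m IH; rewrite addSn => xy; apply: IH.
by apply/eqP; rewrite -mem_ch xy mem_ch.
Qed.

(* The cells [(rk i, code i)] need not be disjoint: two cells with a common point are
   nested, so the descent from [(r, a)] stops at the first of them it meets. *)
Lemma cover_descent (Q : nat -> A -> Prop) (S : set T) n
    (rk : 'I_n -> nat) (code : 'I_n -> A) r a :
  (forall k b, cell k b `<=` cell r a ->
    (forall b', b' \in ch k b -> Q k.+1 b') -> Q k b) ->
  (forall i, cell (rk i) (code i) `<=` cell r a -> Q (rk i) (code i)) ->
  (forall k b, exists x, cell k b x /\ S x) ->
  (forall x, S x -> cell r a x -> exists i, cell (rk i) (code i) x) ->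
  Q r a \/ exists i, (rk i < r)%N /\ cell r a `<=` cell (rk i) (code i).
Proof.
move=> Qch Qi Sx cov; pose N := \max_(i < n) rk i.
have rkN i : (rk i <= N)%N by exact: leq_bigmax.
(* Induction on the remaining depth [m]; beyond rank [N] all the given cells are of strictly smaller
   rank. *)
suff /(_ N.+1 r a) : forall m k b, (N < k + m)%N -> cell k b `<=` cell r a ->
    Q k b \/ exists i, (rk i < k)%N /\ cell k b `<=` cell (rk i) (code i).
  by apply=> //; rewrite addnS ltnS leq_addl.
elim=> [|m IH] k b Nk bra.
  have [x [xb /cov]] := Sx k b; case=> [|i xi]; first exact: bra.
  have ik : (rk i < k)%N by rewrite addn0 in Nk; exact: leq_ltn_trans (rkN i) Nk.
  right; exists i; split=> // y yb; rewrite /= -xi.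
  by apply: code_coarse (ltnW ik) _; rewrite xb yb.
have [|noi] := pselect (exists i, (rk i < k)%N /\ cell k b `<=` cell (rk i) (code i)).
  by right.
left; have [[i [ik ib]]|noi'] := pselect (exists i, rk i = k /\ code i = b).
  by rewrite -ik -ib; apply: Qi; rewrite ik ib.
apply: Qch => // b' b'b; have b'k := cell_child b'b.
have [|//|[i [ik ib']]] := IH k.+1 b' _ (subset_trans b'k bra).
  by rewrite addSn -addnS.
(* A given cell of rank at most [k] containing the child [b'] shares a point with the cell of [b]:
   it is that cell or contains it, and both cases were set aside above. *)
have [x [xb' _]] := Sx k.+1 b'; have xb := b'k _ xb'; have xi := ib' _ xb'.
exfalso; move: ik; rewrite ltnS leq_eqVlt => /orP[/eqP ik|ik].
  by apply: noi'; exists i; split=> //; rewrite -xi ik.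
apply: noi; exists i; split=> // y yb; rewrite /= -xi.
by apply: code_coarse (ltnW ik) _; rewrite xb yb.
Qed.

(** * The stopping argument inside one cell *)

Section StoppedEstimate.
Variables (psi : nat -> A -> R) (E : set T) (g : T -> R) (L : R).
Variables (r : nat) (a : A).

Local Notation J := (cell r a).
Local Notation e k b := (Rintegral nu (cell k b) (\1_E : T -> R)).
(** Passing to a child multiplies the density of [E] by at most [D], so with this threshold a cell
    that has just been stopped still has density at most one half. *)
Local Notation alive k b := (e k b <= v k / (2 * D)).

Hypothesis psi_additive : forall k b, psi k b = \sum_(b' <- ch k b) psi k.+1 b'.
Hypothesis mE : measurable E.
Hypothesis mg : measurable_fun J g.
Hypothesis g_le : forall x, J x -> `|g x| <= L.
Hypothesis psi_le : forall x, J x -> ~ E x ->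
  forall k, `|psi k (c k x)| <= L * v k.

Let D_gt0 : 0 < D. Proof. exact: lt_le_trans D_ge1. Qed.

(* The stopped average after [n] further generations, replaced by the limit [g] on
   [E] and on stopped cells, so that it converges to [g] everywhere on [J] and no
   estimate of the measure of the stopped cells is needed. *)
Fixpoint stopped n k x : R :=
  if n is n'.+1 then
    if alive k.+1 (c k.+1 x) then stopped n' k.+1 x else g x
  else if x \in E then g x else psi k (c k x) / v k.

(** Induction on [n]. The bound of [stopped] by [L] and its pointwise convergence both reduce to
    these two cases. *)
Lemma stopped_alt n k x : stopped n k x = g x \/
  ~ E x /\ stopped n k x = psi (k + n)%N (c (k + n)%N x) / v (k + n)%N.
Proof.
elim: n k => [|n IH] k /=.
  case: ifPn => [_|/negP]; first by left.
  by rewrite in_setE addn0; right.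
by rewrite addnS -addSn; case: ifP => _; [exact: IH|left].
Qed.

Lemma stopped_le n k x : J x -> `|stopped n k x| <= L.
Proof.
move=> Jx; have [->|[Ex ->]] := stopped_alt n k x; first exact: g_le.
by rewrite normrM normfV (gtr0_norm (v_gt0 _)) ler_pdivrMr // psi_le.
Qed.

Lemma measurable_stopped n k : measurable_fun J (stopped n k).
Proof.
have mJ : measurable J by exact: cell_measurable.
elim: n k => [|n IH] k /=; apply: measurable_fun_if => //.
- apply: (measurable_fun_bool true).
  rewrite (_ : (fun x => x \in E) @^-1` _ = E); first exact: measurableI.
  by apply/seteqP; split => x /=; [exact: set_mem|exact: mem_set].
- exact: measurable_funS mg.
- apply: measurable_funM => //.
  apply: (@measurable_code k _ _ _ (psi k)).
  have -> : (fun x => x \in E) @^-1` [set false] = ~` E.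
    apply/seteqP; split => x /=; first by move/negbT/negP; rewrite in_setE.
    by move=> Ex; apply/negbTE/negP; rewrite in_setE.
  by apply: measurableI => //; exact: measurableC.
- exact: (@measurable_code k.+1 _ _ _ (fun b => alive k.+1 b)).
- exact: measurable_funS (IH _).
- exact: measurable_funS mg.
Qed.

Let cell_ltoo k b : (nu (cell k b) < +oo)%E.
Proof. by rewrite nu_cell ltry. Qed.

Let bounded_cell_integrable k b (f : T -> R) : cell k b `<=` J ->
  measurable_fun J f -> (forall x, J x -> `|f x| <= L) ->
  nu.-integrable (cell k b) (EFin \o f).
Proof.
move=> bJ mf fL; apply: (@bounded_integrable _ _ _ _ _ L) => //.
  by apply: measurable_funS mf => //; exact: cell_measurable.
by move=> x /bJ; exact: fL.
Qed.

Let indic_integrable k b : nu.-integrable (cell k b) (EFin \o (\1_E : T -> R)).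
Proof.
apply: (@bounded_integrable _ _ _ _ _ 1) => //.
by move=> x _; rewrite indicE; case: (_ \in _); rewrite ?normr1 ?normr0.
Qed.

Let cst_integrable k b (M : R) : nu.-integrable (cell k b) (EFin \o cst M).
Proof. by apply: (@bounded_integrable _ _ _ _ _ `|M|). Qed.

Let Rintegral_cell_cst k b (M : R) : Rintegral nu (cell k b) (cst M) = M * v k.
Proof. by rewrite Rintegral_cst // nu_cell. Qed.

Let e_ge0 k b : 0 <= e k b.
Proof. by apply: Rintegral_ge0 => x _; exact: ler0n. Qed.

Let e_child k b b' : b' \in ch k b -> e k.+1 b' <= e k b.
Proof.
move=> b'b; rewrite [leRHS]Rintegral_cell // (big_rem b') //= lerDl.
by apply: sumr_ge0 => i _; exact: e_ge0.
Qed.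

(** Some point of the cell lies outside [E], as otherwise [E] would fill the cell; [psi_le] at that
    point gives the bound. *)
Let psi_cell_le k b : cell k b `<=` J -> e k b < v k -> `|psi k b| <= L * v k.
Proof.
move=> bJ eb; have [[x [xb Ex]]|] := pselect (exists x, cell k b x /\ ~ E x).
  by rewrite -{1}xb; apply: psi_le => //; exact: bJ.
move=> /forallNP noE; move: eb; suff -> : e k b = v k by rewrite ltxx.
rewrite -[RHS]mul1r -(Rintegral_cell_cst k b); apply: eq_Rintegral => x.
rewrite in_setE => xb; rewrite /= /indic mem_set //.
by apply: contrapT => Ex; exact: (noE x).
Qed.

Let Rintegral_cell_le k b (f : T -> R) : cell k b `<=` J ->
  measurable_fun J f -> (forall x, J x -> `|f x| <= L) ->
  `|Rintegral nu (cell k b) f| <= L * v k.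
Proof.
move=> bJ mf fL; rewrite -(Rintegral_cell_cst _ b).
apply: le_abs_Rintegral => //; first exact: bounded_cell_integrable.
by move=> x /bJ; exact: fL.
Qed.

(** Induction on [n], with a constant independent of [n]. The error adds up over the children:
    living ones satisfy the induction hypothesis, and on a stopped one [psi] and the integral of [g]
    are each at most [L * v k.+1], itself at most [2 * D * L * e k.+1 b']. *)
Lemma stopped_error n k b : cell k b `<=` J -> alive k b ->
  `|psi k b - Rintegral nu (cell k b) (stopped n k)| <= 4 * D * L * e k b.
Proof.
elim: n k b => [|n IH] k b bJ ab.
  have eb : e k b < v k.
    apply: le_lt_trans ab _; rewrite ltr_pdivrMr ?mulr_gt0 //.
    rewrite ltr_pMr //; have D1 := D_ge1; lra.
  have psiL := psi_cell_le bJ eb.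
  have L_ge0 : 0 <= L by rewrite -(pmulr_lge0 _ (v_gt0 k)); exact: le_trans psiL.
  (* [psi k b] is the integral of its constant average, which differs from [stopped 0 k] only on
     [E], and there by at most [2 * L]. *)
  rewrite -[psi k b](divfK (lt0r_neq0 (v_gt0 k))) -(Rintegral_cell_cst k b).
  have sI : nu.-integrable (cell k b) (EFin \o stopped 0 k).
    apply: bounded_cell_integrable => // [|x]; last exact: stopped_le.
    exact: measurable_stopped.
  rewrite -RintegralB //; last exact: cst_integrable.
  have I2 : nu.-integrable (cell k b) (EFin \o (fun x => 2 * L * \1_E x)).
    by have := integrableZl (cell_measurable k b) (2 * L) (indic_integrable k b).
  apply: (@le_trans _ _ (Rintegral nu (cell k b) (fun x => 2 * L * \1_E x))).
    apply: le_abs_Rintegral => //.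
      exact: (integrableB (cell_measurable k b) (cst_integrable k b _) sI).
    move=> x xb /=; rewrite indicE; case: ifPn => xE.
      rewrite mulr1 mulr_natl mulr2n; apply: le_trans (ler_normB _ _) _.
      rewrite lerD ?g_le //; last exact: bJ.
      by rewrite normrM normfV (gtr0_norm (v_gt0 _)) ler_pdivrMr.
    by rewrite xb subrr normr0 mulr0.
  rewrite RintegralZl // ler_wpM2r ?e_ge0 // ler_wpM2r //.
  by have D1 := D_ge1; lra.
rewrite psi_additive Rintegral_cell; last first.
  by apply: bounded_cell_integrable => // [|x]; [exact: measurable_stopped|exact: stopped_le].
rewrite -sumrB; apply: le_trans (ler_norm_sum _ _ _) _.
rewrite [Rintegral _ (cell k b) _]Rintegral_cell // mulr_sumr.
rewrite big_seq [leRHS]big_seq; apply: ler_sum => b' b'b.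
have b'J : cell k.+1 b' `<=` J by move=> x /(cell_child b'b); exact: bJ.
have [ab'|/negbTE ab'] := boolP (alive k.+1 b').
  rewrite (_ : Rintegral _ _ _ = Rintegral nu (cell k.+1 b') (stopped n k.+1)).
    exact: IH.
  by apply: eq_Rintegral => x; rewrite in_setE /= => ->; rewrite ab'.
rewrite (_ : Rintegral _ _ (stopped _ _) = Rintegral nu (cell k.+1 b') g); last first.
  by apply: eq_Rintegral => x; rewrite in_setE /= => ->; rewrite ab'.
apply: le_trans (ler_normB _ _) _.
have eb' : e k.+1 b' < v k.+1.
  apply: le_lt_trans (e_child b'b) _; apply: le_lt_trans ab _.
  rewrite ltr_pdivrMr ?mulr_gt0 //; have := v_doubling k; have := v_gt0 k.+1.
  by move=> v0; move/le_lt_trans; apply; have D0 := D_gt0; nra.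
have psiL := psi_cell_le b'J eb'.
have L_ge0 : 0 <= L by rewrite -(pmulr_lge0 _ (v_gt0 k.+1)); exact: le_trans psiL.
have gL := Rintegral_cell_le b'J mg g_le.
have : v k.+1 < e k.+1 b' * (2 * D).
  by rewrite -ltr_pdivrMr ?mulr_gt0 // ltNge ab'.
move=> /ltW /(ler_wpM2l L_ge0) h.
apply: le_trans (lerD psiL gL) _; lra.
Qed.

(** Dominated convergence: the stopped averages tend to [g] on the whole cell, and the bound of
    [stopped_error] does not depend on [n]. *)
Lemma cell_estimate : alive r a ->
  (forall x, J x -> ~ E x -> psi k (c k x) / v k @[k --> \oo] --> g x) ->
  `|psi r a - Rintegral nu J g| <= 4 * D * L * e r a.
Proof.
move=> ar cvgg.
have Scvg : Rintegral nu J (stopped n r) @[n --> \oo] --> Rintegral nu J g.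
  have mJ : measurable J by exact: cell_measurable.
  have gI : nu.-integrable J (EFin \o g) by exact: bounded_cell_integrable.
  apply: fine_cvg; rewrite fineK; last exact: integrable_fin_num.
  apply: (@dominated_cvg _ _ _ nu J mJ _ _ (EFin \o cst L)).
  - by move=> n; apply/measurable_EFinP; exact: measurable_stopped.
  - move=> x Jx; apply: cvg_EFin; first exact: nearW.
    have [Ex|Ex] := pselect (E x).
      rewrite (_ : _ \o _ = cst (g x)); first exact: cvg_cst.
      by apply/funext => n /=; have [|[]] := stopped_alt n r x.
    apply/cvgrPdist_le => eps eps0.
    have /cvgrPdist_le /(_ eps eps0) [N _ HN] := cvgg x Jx Ex.
    exists N => // n /= Nn; have [->|[_ ->]] := stopped_alt n r x.
      by rewrite subrr normr0 ltW.
    by apply: HN; rewrite /= (leq_trans Nn) // leq_addl.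
  - by [].
  - exact: cst_integrable.
  - by move=> n x Jx; rewrite lee_fin stopped_le.
have : `|psi r a - Rintegral nu J (stopped n r)| @[n --> \oo] -->
   `|psi r a - Rintegral nu J g|.
  by apply: cvg_norm; apply: cvgB => //; exact: cvg_cst.
by move/cvgr_to_le; apply; apply: nearW => n; exact: stopped_error.
Qed.

End StoppedEstimate.

(** * From a finite cover with comparable values of [H] to a single cell *)

Section CoverEstimate.
Variables (psi : nat -> A -> R) (E I0 : set T) (g H : T -> R) (C : R).

Local Notation w B := (Rintegral nu B (fun x => H x * \1_E x)).

Hypothesis psi_additive : forall k b, psi k b = \sum_(b' <- ch k b) psi k.+1 b'.
Hypothesis mE : measurable E.
Hypothesis mI0 : measurable I0.
Hypothesis mg : measurable_fun I0 g.
Hypothesis integrableH : nu.-integrable I0 (EFin \o H).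
Hypothesis g_le : forall x, I0 x -> `|g x| <= H x.
Hypothesis psi_le : forall x, I0 x -> ~ E x ->
  forall k, `|psi k (c k x)| <= H x * v k.
Hypothesis psi_cvg : forall x, I0 x -> ~ E x ->
  psi k (c k x) / v k @[k --> \oo] --> g x.
Hypothesis C_gt0 : 0 < C.

Let H_ge0 x : I0 x -> 0 <= H x.
Proof. by move/g_le; exact: le_trans. Qed.

Let D_gt0 : 0 < D. Proof. exact: lt_le_trans D_ge1. Qed.

Let integrable_HE : nu.-integrable I0 (EFin \o (fun x => H x * \1_E x)).
Proof.
apply: le_integrable integrableH => //.
  apply/measurable_EFinP; apply: measurable_funM => //.
  by apply/measurable_EFinP; case/integrableP: integrableH.
move=> x Ix /=; rewrite lee_fin normrM ger0_norm ?H_ge0 //= /indic.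
by case: (x \in E); rewrite ?normr1 ?normr0 ?mulr1 ?mulr0 ?H_ge0.
Qed.

Let integrable_g : nu.-integrable I0 (EFin \o g).
Proof.
apply: le_integrable integrableH => //; first exact/measurable_EFinP.
by move=> x Ix /=; rewrite lee_fin (ger0_norm (H_ge0 Ix)) g_le.
Qed.

Let w_subset k b : cell k b `<=` I0 -> w (cell k b) <= w I0.
Proof.
move=> bI; rewrite -[X in _ <= Rintegral _ X _](setDUK bI).
rewrite Rintegral_setU ?setDUK //; last 2 first.
- exact: measurableD.
- by apply/disj_set2P; rewrite setDIK.
by rewrite lerDl; apply: Rintegral_ge0 => x [Ix _]; rewrite mulr_ge0 ?H_ge0.
Qed.

(** This is [cell_estimate] with [L = C * l]. Since [l <= H], the measure of [E] in the cell times
    [l] is at most [w]: this makes the cell alive, and it turns the bound into one by [w]. *)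
Let local_estimate k b (l : R) : cell k b `<=` I0 -> 0 < l ->
  (forall x, cell k b x -> l <= H x <= C * l) ->
  w (cell k b) <= l * v k / (2 * D) ->
  `|psi k b - Rintegral nu (cell k b) g| <= 4 * D * C * w (cell k b).
Proof.
move=> bI l0 lH wl.
have IHE : nu.-integrable (cell k b) (EFin \o (fun x => H x * \1_E x)).
  exact: integrableS integrable_HE.
have IE : nu.-integrable (cell k b) (EFin \o (\1_E : T -> R)).
  apply: (@bounded_integrable _ _ _ _ _ 1) => //.
    by rewrite nu_cell ltry.
  by move=> x _; rewrite /indic; case: (_ \in _); rewrite ?normr1 ?normr0.
have le_w : l * Rintegral nu (cell k b) \1_E <= w (cell k b).
  rewrite -RintegralZl //; apply: le_Rintegral => //.
    exact: (integrableZl (cell_measurable k b) l IE).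
  by move=> x /lH /andP[lHx _]; rewrite ler_wpM2r //; exact: ler0n.
apply: le_trans (_ : 4 * D * (C * l) * Rintegral nu (cell k b) \1_E <= _).
  apply: cell_estimate => //.
  - by apply: measurable_funS mg.
  - by move=> x xb; case/andP: (lH x xb) => _; apply: le_trans; exact/g_le/bI.
  - move=> x xb Ex j; apply: le_trans (psi_le (bI _ xb) Ex j) _.
    by rewrite ler_pM2r //; case/andP: (lH x xb).
  - by rewrite -(ler_pM2l l0) mulrA; exact: le_trans wl.
  - by move=> x xb; apply: psi_cvg; exact: bI.
rewrite [leLHS](_ : _ = 4 * D * C * (l * Rintegral nu (cell k b) \1_E)); last ring.
by rewrite ler_pM2l // !mulr_gt0.
Qed.

(** Descent from [(r, a)]. Either it ends at cells of the cover, where [w0] provides the small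
    density, and the estimates add up; or [(r, a)] lies inside a cell of the cover, whose [l] is at
    least [1] because [C <= H x0 <= C * l], and is estimated directly. Covering is required on [S]
    only, so that a null set may be disregarded. *)
Lemma cover_estimate (S : set T) n (rk : 'I_n -> nat) (code : 'I_n -> A)
    (l : 'I_n -> R) (r : nat) (a : A) (x0 : T) (w0 : R) :
  (forall k b, exists x, cell k b x /\ S x) ->
  (forall x, S x -> I0 x -> exists i, cell (rk i) (code i) x) ->
  (forall i, cell (rk i) (code i) `<=` I0) ->
  (forall i x, cell (rk i) (code i) x -> l i <= H x <= C * l i) ->
  0 < w0 -> (forall i, w0 <= C * l i * v (rk i)) ->
  w I0 <= w0 / (C * (2 * D)) ->
  cell r a `<=` I0 -> cell r a x0 -> C <= H x0 -> w I0 <= v r / (2 * D) ->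
  `|psi r a - Rintegral nu (cell r a) g| <= 4 * D * C * w I0.
Proof.
move=> Sx cov iI lH w0_gt0 w0l ww0 aI ax0 Cx0 wv.
have D0 := D_gt0; have K0 : 0 <= 4 * D * C by rewrite !mulr_ge0 // ltW.
(* The sharper bound by [w (cell r a)] is additive over children, unlike the one by [w I0]. *)
apply: le_trans (_ : _ <= 4 * D * C * w (cell r a)) _; last first.
  by rewrite ler_wpM2l // w_subset.
pose Q k b := `|psi k b - Rintegral nu (cell k b) g| <= 4 * D * C * w (cell k b).
have [k b ba Qb|i ia||//|[i [ri ai]]] := @cover_descent Q S n rk code r a _ _ Sx.
- have bI := subset_trans ba aI.
  rewrite /Q psi_additive !Rintegral_cell; last 2 first.
  + exact: integrableS integrable_HE.
  + exact: integrableS integrable_g.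
  rewrite -sumrB mulr_sumr; apply: le_trans (ler_norm_sum _ _ _) _.
  by rewrite big_seq [leRHS]big_seq; apply: ler_sum => b'; exact: Qb.
- have l0 : 0 < l i.
    have := lt_le_trans w0_gt0 (w0l i).
    by rewrite pmulr_lgt0 // pmulr_rgt0.
  apply: local_estimate l0 _ _ => //.
    exact: lH.
  apply: le_trans (w_subset (iI i)) _; apply: le_trans ww0 _.
  rewrite invfM mulrA ler_pM2r ?invr_gt0 ?mulr_gt0 //.
  by rewrite ler_pdivrMr // mulrC mulrA.
- by move=> x Sx' /aI; exact: cov.
have l1 : 1 <= l i.
  have /andP[_] := lH i x0 (ai _ ax0); move/(le_trans Cx0).
  by rewrite ler_pMr.
apply: (@local_estimate _ _ (l i)) => //; first exact: lt_le_trans l1.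
  by move=> x /ai; exact: lH.
apply: le_trans (w_subset aI) _; apply: le_trans wv _.
by rewrite ler_pM2r ?invr_gt0 ?mulr_gt0 // ler_peMl // ltW.
Qed.

End CoverEstimate.
End CellTree.

(** * Parallelepipeds *)

Lemma lebn_rect (R : realType) n (J : nat -> set R) (l : nat -> R) :
  (forall j, measurable (J j)) -> (forall j, (j < n.+1)%N -> lebesgue_measure (J j) = (l j)%:E) ->
  let B := [set x : ms_type (lebn R n) | forall j, (j < n.+1)%N -> J j (coordn x j)] in
  measurable B /\ ms_meas (lebn R n) B = (\prod_(j < n.+1) l j)%:E.
Proof.
elim: n J l => [|n IH] J l mJ lJ B.
  rewrite (_ : B = J 0%N); last first.
    by apply/seteqP; split => x /= Jx; [exact: (Jx 0%N)|case].
  by split; [exact: mJ|rewrite big_ord1; exact: lJ].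
have [] := IH (fun j => J j.+1) (fun j => l j.+1) (fun j => mJ j.+1).
  by move=> j jn; apply: lJ.
set B' := [set x | _] => mB' lB'.
have -> : B = J 0%N `*` B'.
  apply/seteqP; split => -[x y] /= Bxy.
    by split=> [|j jn]; [exact: (Bxy 0%N)|exact: (Bxy j.+1)].
  by case: Bxy => Jx B'y [|j] jn //=; exact: B'y.
split; first exact: (measurableX (mJ 0%N) mB').
rewrite big_ord_recl EFinM -lB' -lJ //.
exact: (product_measure1E (@lebesgue_measure R) (ms_meas (lebn R n)) (mJ 0%N) mB').
Qed.

Fixpoint pointn (R : realType) n (f : nat -> R) : ms_type (lebn R n) :=
  match n return ms_type (lebn R n) with
  | 0 => f 0%N
  | n'.+1 => (f 0%N, pointn n' (fun j => f j.+1))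
  end.

Lemma coordn_pointn (R : realType) n (f : nat -> R) j :
  (j < n.+1)%N -> coordn (pointn n f) j = f j.
Proof. by elim: n f j => [|n IH] f [|j] //= jn; rewrite IH. Qed.

Section Geometry.
Context (R : realType) (d : nat) (P : nat -> nat -> nat) (Bd : nat).
Hypothesis d_gt0 : (0 < d)%N.
Hypothesis P_ge2 : forall j i, (j < d)%N -> (1 <= i)%N -> (2 <= P j i)%N.
Hypothesis P_le : forall j i, (j < d)%N -> (1 <= i)%N -> (P j i <= Bd)%N.

Let lam : {measure set (Rspace R d) -> \bar R} := @lebd R d.

Lemma lebd_rect (J : nat -> set R) (l : nat -> R) :
  (forall j, measurable (J j)) -> (forall j, (j < d)%N -> lebesgue_measure (J j) = (l j)%:E) ->
  let B := [set x : Rspace R d | forall j, (j < d)%N -> J j (Defs.coord x j)] in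
  measurable B /\ lam B = (\prod_(j < d) l j)%:E.
Proof.
rewrite /lam /lebd /Rspace /Defs.coord => mJ lJ.
have := @lebn_rect R d.-1 J l mJ; rewrite prednK // => /(_ lJ) [mB lB] /=.
split; first exact: caratheodory_measurable_mu_ext.
by rewrite -lB; exact: measurable_mu_extE.
Qed.

Lemma exists_point (f : nat -> R) : exists x : Rspace R d,
  forall j, (j < d)%N -> Defs.coord x j = f j.
Proof.
exists (pointn d.-1 f) => j jd; rewrite /Defs.coord coordn_pointn //.
by rewrite prednK.
Qed.

Let A : countType := {ffun 'I_d -> int}.

(* The fibres of [cell_index k] are the half-open parallelepipeds of rank [k]; they
   partition the space exactly, whereas the closed ones overlap. *)
Definition cell_index k (x : Rspace R d) : A :=
  [ffun j : 'I_d => Num.floor (Defs.coord x j * (mjk P j k)%:R)].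

(* [box] only looks at the indices [j < d]; the others are set to [0]. *)
Definition nat_index (a : A) (j : nat) : int :=
  if insub j is Some i then a i else 0.

Lemma nat_indexE a (j : 'I_d) : nat_index a j = a j.
Proof. by rewrite /nat_index valK. Qed.

Definition cbox k (a : A) : set (Rspace R d) := @Defs.box R d P k (nat_index a).

(** The common Lebesgue measure of all parallelepipeds of rank [k]. *)
Definition vol k : R := \prod_(j < d) ((mjk P j k)%:R)^-1.

Lemma mjk0 j : mjk P j 0 = 1%N.
Proof. by rewrite /mjk big_nil. Qed.

Lemma mjkS j k : mjk P j k.+1 = (mjk P j k * P j k.+1)%N.
Proof. by rewrite /mjk big_nat_recr. Qed.

Lemma mjk_gt0 j k : (j < d)%N -> (0 < mjk P j k)%N.
Proof.
move=> jd; elim: k => [|k IH]; first by rewrite mjk0.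
by rewrite mjkS muln_gt0 IH /=; exact: ltnW (P_ge2 jd _).
Qed.

Let mR_gt0 j k : (j < d)%N -> 0 < (mjk P j k)%:R :> R.
Proof. by move=> jd; rewrite ltr0n mjk_gt0. Qed.

Lemma vol_gt0 k : 0 < vol k.
Proof. by apply: prodr_gt0 => j _; rewrite invr_gt0 mR_gt0. Qed.

(** Each coordinate contributes the factor [P j k.+1], at most [Bd]. *)
Lemma vol_doubling k : vol k <= (Bd ^ d)%:R * vol k.+1.
Proof.
rewrite natrX -[X in _ ^+ X]card_ord -prodr_const -big_split /=.
apply: ler_prod => j _; rewrite invr_ge0 ler0n /= mjkS natrM invfM.
rewrite mulrCA ler_peMr ?invr_ge0 ?ler0n // ler_pdivlMr ?mul1r ?ler_nat ?P_le //.
by rewrite ltr0n; exact: ltnW (P_ge2 _ _).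
Qed.

(** [b] governs the upper faces, included for [false] and excluded for [true], so that closed boxes
    and half-open cells are treated at once. *)
Lemma box_rect k a b : 
  let B := [set x : Rspace R d | forall j, (j < d)%N ->
     Defs.coord x j \in Interval (BLeft ((a j)%:~R / (mjk P j k)%:R)) (BSide b ((a j + 1)%:~R / (mjk P j k)%:R))] in
  measurable B /\ lam B = (vol k)%:E.
Proof.
apply: (@lebd_rect (fun j => [set` Interval (BLeft ((a j)%:~R / (mjk P j k)%:R))
    (BSide b ((a j + 1)%:~R / (mjk P j k)%:R))]) (fun j => (mjk P j k)%:R^-1)) => j.
  exact: measurable_itv.
move=> jd; rewrite lebesgue_measure_itv /=.
have h : (a j + 1)%:~R / (mjk P j k)%:R = (a j)%:~R / (mjk P j k)%:R + (mjk P j k)%:R^-1 :> R.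
  by rewrite intrD mulrDl mul1r.
by rewrite h lte_fin ltrDl invr_gt0 mR_gt0 // -EFinB addrAC subrr add0r.
Qed.

Lemma box_measurable k n : measurable (@Defs.box R d P k n : set (Rspace R d)).
Proof. by have [] := box_rect k n false. Qed.

Lemma lebd_box k n : lam (@Defs.box R d P k n) = (vol k)%:E.
Proof. by have [_ <-] := box_rect k n false. Qed.

Lemma cellE k a : cell_index k @^-1` [set a] =
  [set x | forall j, (j < d)%N ->
     Defs.coord x j \in `[(nat_index a j)%:~R / (mjk P j k)%:R, ((nat_index a j + 1)%:~R / (mjk P j k)%:R)[].
Proof.
apply/seteqP; split => [x /= <- j jd|x /= xa].
  have := floor_itv (Defs.coord x j * (mjk P j k)%:R).
  rewrite (nat_indexE _ (Ordinal jd)) ffunE /= => /andP[h1 h2].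
  by rewrite in_itv /= ler_pdivrMr ?mR_gt0 // h1 ltr_pdivlMr ?mR_gt0.
apply/ffunP => j; rewrite ffunE; apply: floor_def.
have := xa j (ltn_ord j); rewrite nat_indexE in_itv /= => /andP[h1 h2].
by rewrite -ler_pdivrMr ?mR_gt0 // h1 -ltr_pdivlMr ?mR_gt0.
Qed.

Lemma cell_measurable k a : measurable (cell_index k @^-1` [set a]).
Proof. by rewrite cellE; have [] := box_rect k (nat_index a) true. Qed.

Lemma lebd_cell k a : lam (cell_index k @^-1` [set a]) = (vol k)%:E.
Proof. by rewrite cellE; have [] := box_rect k (nat_index a) true. Qed.

Lemma cell_cbox k a : cell_index k @^-1` [set a] `<=` cbox k a.
Proof.
rewrite cellE => x /= xa j jd; have := xa j jd; rewrite in_itv /=.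
by move=> /andP[-> /ltW].
Qed.

(** Irrationality keeps [x] off the upper faces, the only place where a closed box exceeds its
    half-open cell. *)
Lemma P_irrational_cell k n x : P_irrational P x -> @Defs.box R d P k n x ->
  forall j : 'I_d, cell_index k x j = n j.
Proof.
move=> irr xn j; rewrite ffunE; apply: floor_def.
have /andP[h1 h2] := xn j (ltn_ord j).
rewrite -ler_pdivrMr ?mR_gt0 // h1 -ltr_pdivlMr ?mR_gt0 // lt_neqAle h2 andbT.
(* Irrationality speaks of ranks from [1] on; an integer coordinate at rank [0] is excluded through
   rank [1]. *)
apply/eqP => xE; case: k xE {h1 h2 xn} => [|k] xE.
  apply: (irr j (ltn_ord j) 1%N) => //; exists ((n j + 1) * (P j 1%N)%:Z).
  by rewrite xE mjkS !mjk0 mul1n divr1 intrM.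
apply: (irr j (ltn_ord j) k.+1) => //; exists (n j + 1).
by rewrite xE divfK // gt_eqF // mR_gt0.
Qed.

Definition parent k (b : A) : A := [ffun j : 'I_d => (b j %/ (P j k.+1)%:Z)%Z].

(** The offsets run over the uniform range from [0] to [Bd], a finite type, and may leave the
    parent; the filter removes the excess and [undup] gives uniqueness. *)
Definition children k (a : A) : seq A :=
  undup [seq b <- [seq [ffun j : 'I_d => a j * (P j k.+1)%:Z + (t j : nat)%:Z] |
                     t : {ffun 'I_d -> 'I_Bd.+1}]
    | parent k b == a].

Let P_gt0 (j : 'I_d) k : (0 < P j k.+1)%N.
Proof. exact: ltnW (P_ge2 _ _). Qed.

Let P_neq0 (j : 'I_d) k : (P j k.+1)%:Z != 0.
Proof. by rewrite gt_eqF // ltz_nat. Qed.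

(** A code with parent [a] is reached by the offsets given by its remainders modulo [P j k.+1],
    which are below [Bd]. *)
Lemma mem_children k a b : (b \in children k a) = (parent k b == a).
Proof.
rewrite mem_undup mem_filter andb_idr // => /eqP ba.
apply/fintype.imageP; exists [ffun j : 'I_d => inord `|(b j %% (P j k.+1)%:Z)%Z|%N] => //.
apply/ffunP => j; rewrite !ffunE -ba ffunE inordK.
  by rewrite gez0_abs ?modz_ge0 // -divz_eq.
rewrite ltnS (leq_trans _ (P_le (ltn_ord j) (ltn0Sn k))) //.
by rewrite ltnW // -ltz_nat gez0_abs ?modz_ge0 // ltz_pmod ?ltz_nat ?P_gt0.
Qed.

(** In each coordinate, the floor of [floor (y * p) / p] is [floor y] for a positive integer [p]. *)
Lemma parent_cell_index k x : parent k (cell_index k.+1 x) = cell_index k x.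
Proof.
apply/ffunP => j; rewrite !ffunE mjkS natrM mulrA.
set y := Defs.coord x j * _; set p := P j k.+1.
have p_gt0 : 0 < p%:R :> R by rewrite ltr0n P_gt0.
have /andP[h1 h2] := floor_itv (y * p%:R).
move: h1 h2; set f := Num.floor _ => h1 h2.
have fE := divz_eq f p; have := modz_ge0 f (P_neq0 j k); rewrite -/p.
have := @ltz_pmod f p (P_gt0 j k); move: fE.
set q := (f %/ p)%Z; set s := (f %% p)%Z => fE sp s0.
apply/esym/floor_def; rewrite -(ler_pM2r p_gt0) -[X in _ && X](ltr_pM2r p_gt0).
rewrite -[p%:R]/(p%:Z%:~R) -!intrM; apply/andP; split.
  by apply: le_trans h1; rewrite ler_int fE lerDl.
apply: lt_le_trans h2 _; rewrite ler_int fE mulrDl mul1r -addrA lerD2l; lia.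
Qed.

Lemma cell_index_children k x a :
  (cell_index k.+1 x \in children k a) = (cell_index k x == a).
Proof. by rewrite mem_children parent_cell_index. Qed.

Lemma children_cover k a :
  cbox k a = \big[setU/set0]_(b <- children k a) cbox k.+1 b.
Proof.
rewrite -bigcup_seq; apply/seteqP; split => [x xa|x [b /= ]].
  (* On an upper face of the parent the floor is one too large; the minimum moves it back to the
     last child, whose closed box contains the point. *)
  pose b : A := [ffun j : 'I_d =>
    Num.min (cell_index k.+1 x j) (a j * (P j k.+1)%:Z + (P j k.+1)%:Z - 1)].
  have fj (j : 'I_d) : (b j)%:~R <= Defs.coord x j * (mjk P j k.+1)%:R <= (b j + 1)%:~R
      /\ parent k b j = a j.
    have /andP[] := xa j (ltn_ord j); rewrite nat_indexE.
    rewrite ler_pdivrMr ?mR_gt0 // ler_pdivlMr ?mR_gt0 // => h1 h2.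
    rewrite !ffunE mjkS natrM mulrA.
    move: h1 h2; set y := Defs.coord x j * _; set p := P j k.+1 => h1 h2.
    have p_gt0 : 0 < p%:R :> R by rewrite ltr0n P_gt0.
    have pz : 0 < p%:Z by rewrite ltz_nat P_gt0.
    have /andP[f1 f2] := floor_itv (y * p%:R).
    move: f1 f2; set f := Num.floor _ => f1 f2.
    have af : a j * p%:Z <= f.
      by rewrite /f floor_ge_int intrM ler_pM2r.
    split; last first.
      have /andP[s0 sp] : 0 <= Num.min f (a j * p%:Z + p%:Z - 1) - a j * p%:Z < p%:Z.
        by case: leP; lia.
      rewrite -[Num.min _ _](subrK (a j * p%:Z)) addrC divzMDl ?gt_eqF //.
      rewrite divz_small ?addr0 // s0 /=; lia.
    case: (leP f (a j * p%:Z + p%:Z - 1)) => [_|lt_f]; first by rewrite f1 ltW.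
    apply/andP; split; first by apply: le_trans f1; rewrite ler_int ltW.
    rewrite subrK.
    move: h2; rewrite -(ler_pM2r p_gt0) -[X in _ <= _ * X -> _]/(p%:Z%:~R) -intrM.
    by rewrite mulrDl mul1r.
  exists b => /=; first by rewrite mem_children; apply/eqP/ffunP => j; case: (fj j).
  move=> j jd; have [] := fj (Ordinal jd) => /andP[h1 h2] _.
  rewrite (nat_indexE _ (Ordinal jd)) ler_pdivrMr ?mR_gt0 // ler_pdivlMr ?mR_gt0 //.
  by rewrite h1.
rewrite mem_children => /eqP <- xb j jd.
have := xb j jd; rewrite !(nat_indexE _ (Ordinal jd)) ffunE /=.
rewrite !ler_pdivrMr ?mR_gt0 // !ler_pdivlMr ?mR_gt0 //.
rewrite mjkS natrM mulrA; set y := Defs.coord x j * _; set p := P j k.+1.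
set f := b _ => /andP[h1 h2].
have p_gt0 : 0 < p%:R :> R by rewrite ltr0n (P_gt0 (Ordinal jd)).
have fE := divz_eq f p; have := modz_ge0 f (P_neq0 (Ordinal jd) k); rewrite -/p.
have := @ltz_pmod f p (P_gt0 (Ordinal jd) k); move: fE.
set q := (f %/ p)%Z; set s := (f %% p)%Z => fE sp s0.
rewrite -(ler_pM2r p_gt0) -[X in _ && X](ler_pM2r p_gt0).
rewrite -[p%:R]/(p%:Z%:~R) -!intrM; apply/andP; split.
  by apply: le_trans h1; rewrite ler_int fE lerDl.
apply: le_trans h2 _; rewrite ler_int fE mulrDl mul1r -addrA lerD2l; lia.
Qed.

Lemma interior_cbox_disjoint k a b : a != b ->
  interior_d (cbox k a) `&` interior_d (cbox k b) = set0.
Proof.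
move=> ab; apply/seteqP; split => // x [[e1 [e10 xa]] [e2 [e20 xb]]].
move: ab; apply/negP/negPn/eqP/ffunP => j.
wlog : a b e1 e2 e10 e20 xa xb / a j <= b j.
  move=> H; case: (leP (a j) (b j)) => [|/ltW] h; first exact: (H _ _ e1 e2).
  by apply/esym; exact: (H _ _ e2 e1).
move=> ab; apply/eqP; rewrite eq_le ab leNgt; apply/negP => ltab.
(* Moving [x] up by [e1 / 2] stays in the box of [a], although [x] already lies in the box of [b],
   which starts no lower than the box of [a] ends in coordinate [j]. *)
have [y ye] := exists_point (fun i => Defs.coord x i + e1 / 2).
have /xa /(_ j (ltn_ord j)) : forall i, (i < d)%N -> `|Defs.coord y i - Defs.coord x i| < e1.
  move=> i id; rewrite ye // addrAC subrr add0r gtr0_norm; lra.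
have /xb /(_ j (ltn_ord j)) : forall i, (i < d)%N -> `|Defs.coord x i - Defs.coord x i| < e2.
  by move=> i id; rewrite subrr normr0.
rewrite ye // !nat_indexE => /andP[h1 _] /andP[_ h2].
have : (a j + 1)%:~R / (mjk P j k)%:R <= (b j)%:~R / (mjk P j k)%:R :> R.
  by rewrite ler_pM2r ?invr_gt0 ?mR_gt0 // ler_int lezD1.
lra.
Qed.

Lemma additive_children (Psi : set (Rspace R d) -> R[i]) k a : additive_P P Psi ->
  Psi (cbox k a) = \sum_(b <- children k a) Psi (cbox k.+1 b).
Proof.
move=> addP.
pose F (i : 'I_(size (children k a))) := cbox k.+1 (nth a (children k a) i).
rewrite (addP (cbox k a) _ F).
- by rewrite (big_nth a) big_mkord.
- by exists k, (nat_index a).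
- by move=> i; exists k.+1, (nat_index (nth a (children k a) i)).
- by rewrite children_cover (big_nth a) big_mkord.
- move=> i j ij; apply: interior_cbox_disjoint.
  by rewrite nth_uniq // undup_uniq.
Qed.

End Geometry.

(** * Truncated derivatives *)

Section Cmod.
Variable R : realType.
Implicit Types z : R[i].

Lemma cmodE z : cmod z = ComplexField.Normc.normc z.
Proof. by case: z. Qed.

Lemma cmod_ge0 z : 0 <= cmod z. Proof. exact: sqrtr_ge0. Qed.

Lemma cmodD z1 z2 : cmod (z1 + z2) <= cmod z1 + cmod z2.
Proof. by rewrite !cmodE; exact: le_normcD. Qed.

Lemma cmodB z1 z2 : cmod (z1 - z2) = cmod (z2 - z1).
Proof. by case: z1 z2 => [a b] [a' b']; rewrite /cmod /=; congr Num.sqrt; ring. Qed.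

Lemma cmod_dist z1 z2 : `|cmod z1 - cmod z2| <= cmod (z1 - z2).
Proof.
have := cmodD (z1 - z2) z2; have := cmodD (z2 - z1) z1.
rewrite !subrK (cmodB z2 z1) ler_norml => h1 h2; apply/andP; split; lra.
Qed.

Lemma cmodMr z (r : R) : 0 <= r -> cmod (z * r%:C%C) = cmod z * r.
Proof.
move=> r0; rewrite !cmodE ComplexField.Normc.normcM; congr (_ * _).
by rewrite /= expr0n addr0 sqrtr_sqr ger0_norm.
Qed.

Lemma Re_le_cmod z : `|complex.Re z| <= cmod z.
Proof. by rewrite -sqrtr_sqr ler_wsqrtr // lerDl sqr_ge0. Qed.

Lemma Im_le_cmod z : `|complex.Im z| <= cmod z.
Proof. by rewrite -sqrtr_sqr ler_wsqrtr // lerDr sqr_ge0. Qed.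

Lemma cmod_le_ReIm z : cmod z <= `|complex.Re z| + `|complex.Im z|.
Proof.
rewrite -[leRHS]ger0_norm ?addr_ge0 // -sqrtr_sqr ler_wsqrtr //.
by rewrite sqrrD !real_normK ?num_real // -addrA lerD2l lerDr mulrn_wge0 //.
Qed.

(* Lets the real and the imaginary parts be treated simultaneously. *)
Record is_part (phi : R[i] -> R) : Prop := IsPart {
  partB : forall z1 z2, phi (z1 - z2) = phi z1 - phi z2;
  part_le : forall z, `|phi z| <= cmod z;
  partMr : forall z r, phi (z * r%:C%C) = phi z * r }.

Lemma is_part_Re : is_part (@complex.Re R).
Proof.
split; [by move=> [? ?] [? ?]|exact: Re_le_cmod|].
by move=> [a b] r /=; rewrite mulr0 subr0.
Qed.

Lemma is_part_Im : is_part (@complex.Im R).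
Proof.
split; [by move=> [? ?] [? ?]|exact: Im_le_cmod|].
by move=> [a b] r /=; rewrite mulr0 add0r.
Qed.

Section Part.
Variables (phi : R[i] -> R) (phiP : is_part phi).

Lemma part0 : phi 0 = 0.
Proof. by rewrite -[0 in LHS](subrr 0) (partB phiP) subrr. Qed.

Lemma partD z1 z2 : phi (z1 + z2) = phi z1 + phi z2.
Proof.
by rewrite -[z2 in LHS]opprK (partB phiP) -[- z2]sub0r (partB phiP) part0 sub0r opprK.
Qed.

Lemma part_sum (I : Type) (s : seq I) (F : I -> R[i]) :
  phi (\sum_(i <- s) F i) = \sum_(i <- s) phi (F i).
Proof. exact: (big_morph phi partD part0). Qed.

End Part.
End Cmod.

(** * The exceptional null set and the averages of [Psi] *)

Section Main.
Context (R : realType) (d : nat) (P : nat -> nat -> nat) (Bd : nat).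
Variables (Psi : set (Rspace R d) -> R[i]) (I0 : set (Rspace R d)).
Hypothesis d_gt0 : (0 < d)%N.
Hypothesis P_ge2 : forall j i, (j < d)%N -> (1 <= i)%N -> (2 <= P j i)%N.
Hypothesis P_le : forall j i, (j < d)%N -> (1 <= i)%N -> (P j i <= Bd)%N.
Hypothesis additivePsi : additive_P P Psi.

Local Notation lam := (@lebd R d : {measure set (Rspace R d) -> \bar R}).
Local Notation vol := (vol R d P).
Local Notation cidx := (@cell_index R d P).
Local Notation cbox := (@cbox R d P).

Definition bad : set (Rspace R d) :=
  ~` [set x | P_irrational P x /\ exists L, is_Pderiv P Psi x L].

Hypothesis ae_good :
  {ae lam, forall x, P_irrational P x /\ exists L, is_Pderiv P Psi x L}.

Lemma lebd_complete (B : set (Rspace R d)) : lam.-negligible B -> measurable B.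
Proof. exact: measure_is_complete_caratheodory. Qed.

(** Completeness of the measure: measurability of anything confined to the null set [bad] is
    automatic. *)
Lemma bad_subset_measurable B : B `<=` bad -> measurable B.
Proof. by move=> Bb; apply: lebd_complete; exact: negligibleS ae_good. Qed.

Lemma measurable_bad : measurable bad.
Proof. exact: bad_subset_measurable. Qed.

Lemma lebd_bad : lam bad = 0.
Proof. by apply: measure_negligible => //; exact: measurable_bad. Qed.

Lemma notin_bad x : ~ bad x -> P_irrational P x /\ is_Pderiv P Psi x (Pderiv P Psi x).
Proof.
move=> /contrapT [irr [L xL]]; split=> //.
suff [] : [set L | P_irrational P x /\ is_Pderiv P Psi x L] (Pderiv P Psi x) by [].
by apply: xgetPex; exists L.
Qed.

(** Cells have positive measure and [bad] is null. *)
Lemma cell_notin_bad k a : exists x, cidx k x = a /\ ~ bad x.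
Proof.
apply: contrapT => /forallNP nox.
suff cell0 : lam (cidx k @^-1` [set a]) = 0%E.
  have := etrans (esym (lebd_cell R d_gt0 P_ge2 k a)) cell0.
  by move=> []; apply/eqP; rewrite gt_eqF // vol_gt0.
apply/eqP; rewrite eq_le measure_ge0 andbT -lebd_bad le_measure ?inE //.
- exact: cell_measurable.
- exact: measurable_bad.
- by move=> x xa; apply: contrapT => xb; apply: (nox x).
Qed.

Lemma box_cbox k n : @Defs.box R d P k n = cbox k [ffun j : 'I_d => n j].
Proof.
apply/seteqP; split => x xn j jd; have := xn j jd.
  by rewrite (nat_indexE _ (Ordinal jd)) ffunE.
by rewrite (nat_indexE _ (Ordinal jd)) ffunE.
Qed.

Lemma Lambda_cbox I : Lambda P I -> exists k a, I = cbox k a.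
Proof. by move=> [k [n ->]]; exists k, [ffun j : 'I_d => n j]; exact: box_cbox. Qed.

Lemma mu_cbox k a : mu (cbox k a) = vol k.
Proof. exact: (congr1 fine (lebd_box R d_gt0 P_ge2 k _)). Qed.

Definition avg k a : R[i] := Psi (cbox k a) * ((vol k)^-1)%:C%C.

Lemma cmod_avg k a : cmod (avg k a) = cmod (Psi (cbox k a)) / vol k.
Proof. by rewrite cmodMr // invr_ge0 ltW // vol_gt0. Qed.

Lemma cvg_avg x : ~ bad x ->
  cmod (avg k (cidx k x) - Pderiv P Psi x) @[k --> \oo] --> 0.
Proof.
move=> /notin_bad [irr xL]; apply/cvgr0Pnorm_lt => e /xL [K KP].
exists K => // k /= Kk; rewrite ger0_norm ?cmod_ge0 //.
rewrite /avg -(mu_cbox k (cidx k x)); apply: (KP k Kk).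
  by exists (nat_index (cidx k x)).
exact: cell_cbox.
Qed.

Lemma cvg_part_avg (phi : R[i] -> R) x : is_part phi -> ~ bad x ->
  phi (Psi (cbox k (cidx k x))) / vol k @[k --> \oo] --> phi (Pderiv P Psi x).
Proof.
move=> phiP xb; apply/cvgrPdist_lt => e e0.
have /cvgr0Pnorm_lt /(_ _ e0) [K _ KP] := cvg_avg xb.
exists K => // k /KP; apply: le_lt_trans.
rewrite -(partMr phiP) -(partB phiP) (ger0_norm (cmod_ge0 _)) cmodB.
exact: part_le.
Qed.

Lemma cvg_cmod_avg x : ~ bad x ->
  cmod (avg k (cidx k x)) @[k --> \oo] --> cmod (Pderiv P Psi x).
Proof.
move=> xb; apply/cvgrPdist_lt => e e0.
have /cvgr0Pnorm_lt /(_ _ e0) [K _ KP] := cvg_avg xb.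
exists K => // k /KP; apply: le_lt_trans.
by rewrite (ger0_norm (cmod_ge0 _)) (cmodB (avg _ _)) cmod_dist.
Qed.

(** * Truncation by a fixed function [H] *)

Section Truncation.
Variable H : Rspace R d -> R.
Hypothesis mI0 : measurable I0.
Hypothesis mH : measurable_fun I0 H.
Hypothesis H_ge0 : forall x, I0 x -> 0 <= H x.

Definition exceed : set (Rspace R d) :=
  [set x | I0 x /\ P_irrational P x /\ ((H x)%:E < Pmax P Psi x)%E].

Lemma Pmax_gtP x r : (r%:E < Pmax P Psi x)%E <->
  exists k a, cbox k a x /\ r < cmod (avg k a).
Proof.
split=> [/ereal_sup_gt[_ [I [/Lambda_cbox[k [a ->]] xa] <-]]|[k [a [xa rx]]]].
  by rewrite lte_fin => rx; exists k, a; rewrite cmod_avg -(mu_cbox k a).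
apply/ereal_sup_gtP; exists (cmod (Psi (cbox k a)) / mu (cbox k a))%:E.
  by exists (cbox k a) => //; split=> //; exists k, (nat_index a).
by rewrite lte_fin mu_cbox -cmod_avg.
Qed.

(** The supremum exceeds [H x] exactly when one average does, so among irrational points the set is
    a countable union indexed by the boxes. *)
Lemma measurable_exceed : measurable exceed.
Proof.
have -> : exceed = [set x | P_irrational P x] `&`
   \bigcup_k \bigcup_a (cbox k a `&` (I0 `&` [set x | H x < cmod (avg k a)])).
  apply/seteqP; split => x /=.
    move=> [Ix [irr /Pmax_gtP[k [a [xa rx]]]]]; split=> //.
    by exists k => //; exists a.
  move=> [irr [k _ [a _ [xa [Ix rx]]]]]; split=> //; split=> //.
  by apply/Pmax_gtP; exists k, a.
apply: measurableI.
  rewrite -[X in measurable X]setCK; apply: measurableC.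
  by apply: bad_subset_measurable => x /= nirr [irr _].
apply: bigcupT_measurable => k.
apply: countable_bigcupT_measurable => [|a]; first exact: countableP.
apply: measurableI; first exact: box_measurable.
rewrite (_ : [set x | _] = H @^-1` `]-oo, cmod (avg k a)[%classic).
  exact: mH (measurable_itv _).
by apply/seteqP; split => x /=; rewrite in_itv.
Qed.

Lemma notin_exceed x : I0 x -> ~ (bad `|` exceed) x ->
  forall k a, cbox k a x -> cmod (Psi (cbox k a)) <= H x * vol k.
Proof.
move=> Ix /not_orP[xb xe] k a xa; rewrite leNgt; apply/negP => hx; apply: xe.
have [irr _] := notin_bad xb; split=> //; split=> //.
apply/Pmax_gtP; exists k, a; split=> //.
by rewrite cmod_avg ltr_pdivlMr // vol_gt0.
Qed.

(** All averages at [x] have modulus at most [H x], hence so has their limit. *)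
Lemma trunc_notin_exceed x : I0 x -> ~ (bad `|` exceed) x ->
  trunc (Pderiv P Psi) H x = Pderiv P Psi x.
Proof.
move=> Ix xbe; have /not_orP[xb _] := xbe; rewrite /trunc ifT //.
apply: cvgr_to_le (cvg_cmod_avg xb) _; apply: nearW => k.
rewrite cmod_avg ler_pdivrMr ?vol_gt0 //; apply: notin_exceed => //.
exact: cell_cbox.
Qed.

(** Off [bad] the derivative is a pointwise limit of functions of the cell index; on [bad] every
    function is measurable. *)
Lemma measurable_part_trunc (phi : R[i] -> R) : is_part phi ->
  measurable_fun I0 (phi \o trunc (Pderiv P Psi) H).
Proof.
move=> phiP.
have mI0b : measurable (I0 `\` bad) by apply: measurableD => //; exact: measurable_bad.
rewrite -(setUIDK I0 bad).
apply/measurable_funU => //; first by apply: bad_subset_measurable => x [].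
split.
  move=> _ Y _; apply: bad_subset_measurable.
  by move=> x [[]].
have -> : phi \o trunc (Pderiv P Psi) H =
    fun x => if cmod (Pderiv P Psi x) <= H x then phi (Pderiv P Psi x) else 0.
  by apply/funext => x /=; rewrite /trunc; case: ifP => // _; exact: part0.
have mlim (f : nat -> {ffun 'I_d -> int} -> R) (g : Rspace R d -> R) :
    (forall x, ~ bad x -> f k (cidx k x) @[k --> \oo] --> g x) ->
    measurable_fun (I0 `\` bad) g.
  move=> fg; apply: (@measurable_fun_cvg _ _ _ _ (fun k => f k \o cidx k)).
    by move=> k; apply: measurable_code => //; exact: cell_measurable.
  by move=> x [_ xb]; exact: fg.
apply: measurable_fun_if => //.
- apply: measurable_fun_ler; last exact: measurable_funS mH.
  by apply: (mlim (fun k a => cmod (avg k a))) => x; exact: cvg_cmod_avg.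
- apply: (@measurable_funS _ _ _ _ (I0 `\` bad)) => //.
  by apply: (mlim (fun k a => phi (Psi (cbox k a)) / vol k)) => x; exact: cvg_part_avg.
Qed.

Local Notation D := ((Bd ^ d)%:R : R).
Local Notation w := (fine (\int[lam]_(x in exceed) (H x)%:E)%E).

(** Since [bad] is null, the weight of the cell estimates is the integral that the theorem assumes
    to tend to zero. *)
Lemma Rintegral_exceed :
  Rintegral lam I0 (fun x => H x * \1_(bad `|` exceed) x) = w.
Proof.
have mbad := measurable_bad; have mexc := measurable_exceed.
have mE : measurable (bad `|` exceed) by exact: measurableU.
have mEH B : B `<=` I0 -> measurable B -> measurable_fun B (EFin \o H).
  by move=> BI mB; apply/measurable_EFinP; exact: measurable_funS mH.
have eI : exceed `<=` I0 by move=> x [].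
transitivity (Rintegral lam (I0 `&` (bad `|` exceed)) H).
  rewrite Rintegral_mkcondr; apply: eq_Rintegral => x _ /=.
  by rewrite patchE /indic; case: (x \in _); rewrite ?mulr1 ?mulr0.
rewrite /Rintegral; congr fine.
rewrite (@ge0_negligible_integral _ _ _ _ _ bad) //; last 4 first.
- exact: measurableI.
- by apply: mEH; [exact: subIsetl|exact: measurableI].
- by move=> x [Ix _]; rewrite lee_fin H_ge0.
- exact: lebd_bad.
rewrite [RHS](@ge0_negligible_integral _ _ _ _ _ bad) //; last 3 first.
- exact: mEH.
- by move=> x [Ix _]; rewrite lee_fin H_ge0.
- exact: lebd_bad.
congr integral; apply/seteqP; split => x.
  by move=> [[Ix [//|xe]] xb].
by move=> [xe xb]; split=> //; split; [exact: eI|right].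
Qed.

(** Off the null set [bad] the closed box and its half-open cell coincide. *)
Lemma Rintegral_cbox k a (f : Rspace R d -> R) :
  lam.-integrable (cbox k a) (EFin \o f) ->
  Rintegral lam (cbox k a) f = Rintegral lam (cidx k @^-1` [set a]) f.
Proof.
move=> fi; have mbad := measurable_bad; have mcell : measurable (cidx k @^-1` [set a]) by exact: cell_measurable.
have mbox : measurable (cbox k a) by exact: box_measurable.
have sub : cidx k @^-1` [set a] `<=` cbox k a by exact: cell_cbox.
rewrite /Rintegral; congr fine.
rewrite (negligible_integral mbad mbox fi lebd_bad).
rewrite [RHS](negligible_integral mbad mcell (integrableS mbox mcell sub fi) lebd_bad).
congr integral; apply/seteqP; split => x [xa xb]; split=> //; last exact: sub.
have [irr _] := notin_bad xb; apply/ffunP => j.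
by rewrite (P_irrational_cell P_ge2 irr xa) nat_indexE.
Qed.

Lemma Bd_ge1 : 1 <= D.
Proof.
have := leq_trans (P_ge2 d_gt0 (ltn0Sn 0)) (P_le d_gt0 (ltn0Sn 0)).
by move=> B2; rewrite -[1]/(1%:R) ler_nat expn_gt0 (ltnW B2).
Qed.

(** Instance of [cover_estimate] with the union of [bad] and [exceed] as [E] and the complement of
    [bad] as [S]: on the latter, a point of a closed box lies in its half-open cell. *)
Lemma part_estimate (phi : R[i] -> R) n (rk : 'I_n -> nat)
    (code : 'I_n -> {ffun 'I_d -> int}) (l : 'I_n -> R) (C w0 : R) r a x0 :
  is_part phi -> (lam I0 < +oo)%E -> 0 < C ->
  (forall x, I0 x -> exists i, cbox (rk i) (code i) x) ->
  (forall i, cbox (rk i) (code i) `<=` I0) ->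
  (forall i x, cbox (rk i) (code i) x -> l i <= H x <= C * l i) ->
  0 < w0 -> (forall i, w0 <= C * l i * vol (rk i)) ->
  w <= w0 / (C * (2 * D)) ->
  cbox r a `<=` I0 -> cidx r x0 = a -> C <= H x0 -> w <= vol r / (2 * D) ->
  `|phi (Psi (cbox r a)) -
    Rintegral lam (cbox r a) (phi \o trunc (Pderiv P Psi) H)| <= 4 * D * C * w.
Proof.
move=> phiP I0oo C_gt0 cov iI lH w0_gt0 w0l ww0 aI x0a Cx0 wv.
have trunc_le x : I0 x -> `|phi (trunc (Pderiv P Psi) H x)| <= H x.
  move=> Ix; rewrite /trunc; case: ifP => [|_]; last by rewrite part0 // normr0 H_ge0.
  by apply: le_trans; exact: part_le.
(* Finitely many pieces cover [I0] and [H] is at most [C * l i] on each, so [H] is bounded, hence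
   integrable. *)
have H_le x : I0 x -> `|H x| <= \sum_i `|C * l i|.
  move=> Ix; rewrite ger0_norm ?H_ge0 //; have [i xi] := cov x Ix.
  have /andP[_ /le_trans] := lH i x xi; apply; apply: le_trans (ler_norm _) _.
  by rewrite (bigD1 i) //= lerDl sumr_ge0.
have HI : lam.-integrable I0 (EFin \o H) by exact: bounded_integrable H_le.
have mg := measurable_part_trunc phiP.
have gI : lam.-integrable I0 (EFin \o (phi \o trunc (Pderiv P Psi) H)).
  apply: bounded_integrable => // x Ix; apply: le_trans (H_le x Ix).
  by rewrite (ger0_norm (H_ge0 Ix)); exact: trunc_le.
rewrite Rintegral_cbox; last by apply: integrableS gI => //; exact: box_measurable.
rewrite -Rintegral_exceed in ww0 wv *.
have sub k b : cidx k @^-1` [set b] `<=` cbox k b by exact: cell_cbox.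
apply: (@cover_estimate _ _ _ lam _ cidx (children P Bd) vol D _ _ _ Bd_ge1
  _ _ _ (fun k b => phi (Psi (cbox k b))) (bad `|` exceed) I0
  (phi \o trunc (Pderiv P Psi) H) H C _ _ _ _ _ _ _ _ C_gt0 (~` bad) n rk code l
  r a x0 w0) => //.
- by move=> k b; exact: cell_measurable.
- by move=> k b; exact: lebd_cell.
- by move=> k; exact: vol_gt0.
- by move=> k; exact: vol_doubling.
- by move=> k b; exact: undup_uniq.
- by move=> k x b; exact: cell_index_children.
- by move=> k b; rewrite (additive_children d_gt0 P_ge2 P_le) // part_sum.
- by apply: measurableU; [exact: measurable_bad|exact: measurable_exceed].
- move=> x Ix xE k; apply: le_trans (part_le phiP _) _.
  by apply: notin_exceed => //; exact: sub.
- move=> x Ix xE; rewrite /= trunc_notin_exceed //; apply: cvg_part_avg => //.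
  by case/not_orP: xE.
- by move=> k b; have [x] := cell_notin_bad k b; exists x.
- move=> x xb Ix; have [i xi] := cov x Ix; exists i; have [irr _] := notin_bad xb.
  by apply/ffunP => j; rewrite (P_irrational_cell P_ge2 irr xi) nat_indexE.
- by move=> i; apply: subset_trans (iI i); exact: sub.
- by move=> i x xi; apply: lH; exact: sub.
- by apply: subset_trans aI; exact: sub.
Qed.

End Truncation.

End Main.

(** * Assembling the estimates along the sequence [h] *)

Unset Implicit Arguments.

Theorem theorem3 (R : realType) (d : nat) (P : nat -> nat -> nat)
    (Psi : set (Rspace R d) -> R[i]) (I0 : set (Rspace R d))
    (h : nat -> Rspace R d -> R) :
  (1 <= d)%N ->
  (forall j i, (j < d)%N -> (1 <= i)%N -> (2 <= P j i)%N) ->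
  (exists B : nat, forall j i, (j < d)%N -> (1 <= i)%N -> (P j i <= B)%N) ->
  additive_P P Psi ->
  Lambda P I0 ->
  (forall m, measurable_fun I0 (h m)) ->
  (* (i) *)
  (forall x, I0 x -> 0 <= h 0%N x) ->
  (forall m x, I0 x -> h m x <= h m.+1 x) ->
  (forall x, I0 x -> h ^~ x @ \oo --> +oo) ->
  (* (ii) and (iii) *)
  (exists C : R, 0 < C /\
     exists (nm : nat -> nat) (Ip : forall m, 'I_(nm m) -> set (Rspace R d)),
       (forall m k, Lambda P (Ip m k)) /\
       (forall m k k', k != k' ->
          interior_d (Ip m k) `&` interior_d (Ip m k') = set0) /\
       (forall m, \big[setU/set0]_(k < nm m) Ip m k = I0) /\
       (forall m k, (ereal_sup [set (h m x)%:E | x in Ip m k]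
                     <= C%:E * ereal_inf [set (h m x)%:E | x in Ip m k])%E) /\
       (0 < ereal_inf [set y | exists m (k : 'I_(nm m)),
                        y = (\int[@lebd R d]_(x in Ip m k) (h m x)%:E)%E])%E) ->
  (fun m => (\int[@lebd R d]_(x in [set x | I0 x /\ P_irrational P x /\
                                           ((h m x)%:E < Pmax P Psi x)%E])
              (h m x)%:E)%E) @ \oo --> 0%E ->
  {ae @lebd R d, forall x, P_irrational P x /\ exists L, is_Pderiv P Psi x L} ->
  forall I, Lambda P I -> I `<=` I0 ->
    (fun m => cmod (Psi I - cintegral I (trunc (Pderiv P Psi) (h m)))) @ \oo --> 0.
Proof.
move=> d_gt0 P_ge2 [Bd P_le] addPsi LI0 mh h0_ge0 h_nd h_oo.
move=> [C [C_gt0 [nm [Ip [LIp [_ [Ip_cover [Ip_osc inf_gt0]]]]]]]] cvg_exceed aegood I LI II0.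
have h_ge0 m x : I0 x -> 0 <= h m x.
  move=> Ix; elim: m => [|m IH]; first exact: h0_ge0.
  by apply: le_trans IH _; exact: h_nd.
have [w0 [w0_gt0 w0_le]] : exists w0 : R, 0 < w0 /\ forall m (k : 'I_(nm m)),
    (w0%:E <= \int[@lebd R d]_(x in Ip m k) (h m x)%:E)%E.
  move: inf_gt0; set y := ereal_inf _ => y_gt0.
  have y_le m k : (y <= \int[@lebd R d]_(x in Ip m k) (h m x)%:E)%E.
    by apply: ereal_inf_lbound; exists m, k.
  move: y y_gt0 y_le => [w0| |] // y_gt0 y_le; first by exists w0.
  (* An infinite infimum: any positive real will do. *)
  by exists 1; split=> // m k; apply: le_trans (y_le m k); rewrite leey.
have I0P m x : I0 x <-> exists k, Ip m k x.
  rewrite -{1}(Ip_cover m) -bigcup_seq; split=> [[k _ xk]|[k xk]]; exists k => //.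
  by rewrite /= mem_index_enum.
have IpI0 m k : Ip m k `<=` I0 by move=> x xk; apply/(I0P m); exists k.
have [r [a IE]] := Lambda_cbox LI.
have [r0 [a0 I0E]] := Lambda_cbox LI0.
have mI0 : measurable I0 by rewrite I0E; exact: box_measurable.
have I0oo : ((@lebd R d : {measure set (Rspace R d) -> \bar R}) I0 < +oo)%E.
  by rewrite I0E; apply: le_lt_trans (ltry (vol R d P r0)); rewrite -(lebd_box R d_gt0 P_ge2 r0 (nat_index a0)).
(* [l] is the infimum of [h m] over the piece, finite because the piece is nonempty and [h m] is
   nonnegative there. *)
have osc m k : exists l : R, forall x, Ip m k x -> l <= h m x <= C * l.
  have [k' [b Ipb]] := Lambda_cbox (LIp m k).
  have [y [yb _]] := cell_notin_bad d_gt0 P_ge2 aegood k' b.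
  have yIp : Ip m k y by rewrite Ipb; exact: (cell_cbox P_ge2).
  set i := ereal_inf [set (h m x)%:E | x in Ip m k].
  have i_le x : Ip m k x -> (i <= (h m x)%:E)%E.
    by move=> xk; apply: ereal_inf_lbound; exists x.
  have i_fin : i \is a fin_num.
    rewrite ge0_fin_numE; first exact: le_lt_trans (i_le y yIp) (ltry _).
    by apply: le_ereal_inf_tmp => _ [x xk <-]; rewrite lee_fin h_ge0 //; exact: IpI0 xk.
  exists (fine i) => x xk; rewrite -!lee_fin EFinM fineK // i_le //=.
  apply: le_trans (Ip_osc m k); apply: ereal_sup_ubound; by exists x.
(* This point of [I] is chosen before [m], so that [C <= h m x0] holds eventually. *)
have [x0 [x0r x0bad]] := cell_notin_bad d_gt0 P_ge2 aegood r a.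
have I0x0 : I0 x0 by apply: II0; rewrite IE; exact: (cell_cbox P_ge2).
pose W m := fine (\int[@lebd R d]_(x in exceed P Psi I0 (h m)) (h m x)%:E)%E.
have cvgW : W m @[m --> \oo] --> 0 by exact: fine_cvg.
pose K : R := 4 * (Bd ^ d)%:R * C.
have K_gt0 : 0 < K.
  by rewrite !mulr_gt0 // (lt_le_trans ltr01) //; exact: (Bd_ge1 _ d_gt0 P_ge2).
have v_gt0 : 0 < vol R d P r by exact: vol_gt0.
(* One threshold for [m] serves every [phi], hence the real and imaginary parts together. *)
have part_le : \forall m \near \oo, forall phi : R[i] -> R, is_part phi ->
    `|phi (Psi I) - Rintegral (@lebd R d) I (phi \o trunc (Pderiv P Psi) (h m))|
      <= K * W m.
  have D_gt0 : 0 < (Bd ^ d)%:R :> R.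
    by rewrite (lt_le_trans ltr01) //; exact: (Bd_ge1 _ d_gt0 P_ge2).
  (* The two bounds that [W m] must eventually meet: the first for the pieces of the cover, the
     second for [I] inside a single piece. *)
  have t1_gt0 : 0 < w0 / (C * (2 * (Bd ^ d)%:R)) by rewrite divr_gt0 ?mulr_gt0.
  have t2_gt0 : 0 < vol R d P r / (2 * (Bd ^ d)%:R) by rewrite divr_gt0 ?mulr_gt0.
  near=> m => phi phiP.
  have [l lP] := choice (osc m).
  have [rk rkP] := choice (fun k => Lambda_cbox (LIp m k)).
  have [code codeP] := choice rkP.
  rewrite {1 2}IE.
  apply: (@part_estimate R d P Bd Psi I0 d_gt0 P_ge2 P_le addPsi aegood (h m) mI0
    (mh m) (h_ge0 m) phi (nm m) rk code l C w0 r a x0) => //.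
  - by move=> x; rewrite (I0P m) => -[k xk]; exists k; rewrite -codeP.
  - by move=> k; rewrite -codeP.
  - by move=> k x; rewrite -codeP; exact: lP.
  (* Hypothesis (iii) enters here: [w0] is at most the integral of [h m] over the piece, itself at
     most [C * l k] times its volume. *)
  - move=> k; rewrite -lee_fin; apply: le_trans (w0_le m k) _.
    have mIp : measurable (Ip m k) by rewrite codeP; exact: box_measurable.
    rewrite EFinM -(lebd_box R d_gt0 P_ge2 (rk k) (nat_index (code k))).
    move: mIp; rewrite -[@Defs.box _ _ _ _ _]/(cbox P (rk k) (code k)) -codeP => mIp.
    rewrite -integral_cst //.
    apply: ge0_le_integral => //.
    + by move=> x /IpI0 Ix; rewrite lee_fin h_ge0.
    + by apply/measurable_EFinP; apply: measurable_funS (mh m) => //; exact: IpI0.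
    + by move=> x xk; case/andP: (lP k x xk) => _; rewrite lee_fin.
  - by near: m; apply: (cvgr_le _ cvgW).
  - by rewrite -IE.
  - by near: m; move/cvgryPge : (h_oo x0 I0x0); apply.
  - by near: m; apply: (cvgr_le _ cvgW).
have cvgKW : K * W m + K * W m @[m --> \oo] --> 0.
  by rewrite -[0 in X in _ --> X](addr0 0) -[0 in X in _ --> X](mulr0 K);
    apply: cvgD; apply: cvgMr.
apply: (@squeeze_cvgr _ _ _ _ (cst 0)) cvgKW; last exact: cvg_cst.
near=> m; rewrite cmod_ge0 /=.
have pm : forall phi : R[i] -> R, is_part phi ->
    `|phi (Psi I) - Rintegral (@lebd R d) I (phi \o trunc (Pderiv P Psi) (h m))|
      <= K * W m by near: m.
apply: le_trans (cmod_le_ReIm _) _; apply: lerD.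
  rewrite (partB (is_part_Re R)); exact: pm (is_part_Re R).
rewrite (partB (is_part_Im R)); exact: pm (is_part_Im R).
Unshelve. all: by end_near.
Qed.
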